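(* Let $J\subset F[d_x,d_y]$ be a (non-holonomic) left ideal of differential type $1$, let $\overline J\subset R$ be the left ideal of $R=F[d_x,d_y](F[d_y])^{-1}$ generated by $J$, and let $p\in J$ be such that $\overline J=Rp$. Let $H$ be a fractional-derivatives series with respect to $G=G_{s_2,\dots,s_k}(f_1,\dots,f_k)$ with $d_yf_1\neq0$. Then $H$ is a solution of the linear partial differential equation $p=0$ if and only if $H$ is a solution of the ideal $J$.
   Context: $F$ is a differentially closed (universal in the sense of Kolchin) differential field of characteristic $0$ with two commuting derivations $d_x,d_y$; $F[d_x,d_y]$ is the ring of linear partial differential operators over $F$. A left ideal $J$ has differential type $1$ if its Hilbert–Kolchin polynomial $K_J(z)$ (equal for large integers $z$ to $\dim_F$ of the operators of order $\le z$ modulo those lying in $J$) has degree $1$. $R=F[d_x,d_y](F[d_y])^{-1}=(F[d_y])^{-1}F[d_x,d_y]$ is the Ore localization of $F[d_x,d_y]$ at the non-zero elements of $F[d_y]$. It is left-euclidean with respect to $d_x$, so every left ideal $\overline J$ is principal, and a generator may be chosen in $J$. Let $k\ge1$, let $1>s_2>\cdots>s_k>0$ be rational and $f_1,\dots,f_k\in F$. The symbol $G=G^{(0)}=G_{s_2,\dots,s_k}(f_1,\dots,f_k)$ comes with $F$-linearly independent formal symbols $\{G^{(s)}\}_{s\in\mathbb Q}$ and the rule $dG^{(s)}=(df_1)G^{(1+s)}+(df_2)G^{(s_2+s)}+\cdots+(df_k)G^{(s_k+s)}$ for $d\in\{d_x,d_y\}$. With $q$ the common denominator of $s_2,\dots,s_k$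 ($q=1$ if $k=1$), a fractional-derivatives series is a formal series $H=\sum_{0\le i<\infty}h_iG^{(s_0-i/q)}$ with $h_i\in F$, $s_0q\in\mathbb Z$. Operators act termwise via the Leibniz rule and the rule above. $H$ is a solution of $p=0$ if $pH=0$, and a solution of $J$ if $p_0H=0$ for all $p_0\in J$. *)

(* Defs.v *)
From HB Require Import structures.
From mathcomp Require Import all_boot all_order all_algebra.
From mathcomp Require Import boolp classical_sets functions.

Set Implicit Arguments.
Unset Strict Implicit.
Unset Printing Implicit Defensive.

Import Order.TTheory GRing.Theory Num.Theory.
Local Open Scope classical_set_scope.
Local Open Scope ring_scope.

(** * Differential fields with two commuting derivations *)

HB.mixin Record Field_hasDerivations F of GRing.Field F := {
  dx : F -> F;
  dy : F -> F;
  dxD : {morph dx : a b / a + b};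
  dyD : {morph dy : a b / a + b};
  dxM : forall a b, dx (a * b) = dx a * b + a * dx b;
  dyM : forall a b, dy (a * b) = dy a * b + a * dy b;
  dxdyC : forall a, dx (dy a) = dy (dx a)
}.

#[short(type="diffFieldType")]
HB.structure Definition DiffField := {F of GRing.Field F & Field_hasDerivations F}.

Definition diff_morphism (K L : diffFieldType) (phi : {rmorphism K -> L}) : Prop :=
  (forall a, phi (dx a) = dx (phi a)) /\ (forall a, phi (dy a) = dy (phi a)).

Definition diff_subfield (K : diffFieldType) (P : set K) : Prop :=
  [/\ P 1, forall a b, P a -> P b -> P (a - b),
      forall a b, P a -> P b -> P (a * b), forall a, P a -> P a^-1
    & forall a, P a -> P (dx a) /\ P (dy a)].

Definition diff_generates (K : diffFieldType) (A : set K) : Prop :=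
  forall P : set K, diff_subfield P -> A `<=` P -> P = setT.

(** Kolchin: [F] is a universal differential field when, for every finitely
    generated differential field [k] (over the prime field) contained in [F],
    every finitely generated differential extension [E] of [k] embeds into [F]
    over [k].  The inclusions of [k] in [F] and in [E] are the maps [j], [i]. *)
Definition kolchin_universal (F : diffFieldType) : Prop :=
  forall (k E : diffFieldType)
         (j : {rmorphism k -> F}) (i : {rmorphism k -> E}),
    diff_morphism j -> diff_morphism i ->
    (exists s : seq k, diff_generates [set` s]) ->
    (exists t : seq E, diff_generates (range i `|` [set` t])) ->
    exists phi : {rmorphism E -> F},
      diff_morphism phi /\ forall a, phi (i a) = j a.

(** * The ring [F[d_x, d_y]] *)

(** The operator [\sum_(i, j) a_ij d_x^i d_y^j] is encoded by its coefficients: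
    [a_ij] is [(symb p)`_i`_j]. *)
Record pdo (F : diffFieldType) := Pdo { symb : {poly {poly F}} }.

HB.instance Definition _ (F : diffFieldType) := [isNew for @symb F].
HB.instance Definition _ (F : diffFieldType) := [Equality of pdo F by <:].
HB.instance Definition _ (F : diffFieldType) := [Choice of pdo F by <:].

Section PdoModule.
Variable F : diffFieldType.
Implicit Types (p q : pdo F) (a b : F).

Lemma symb_inj : injective (@symb F).
Proof. exact: val_inj. Qed.

Lemma symbP p q : (forall i j, (symb p)`_i`_j = (symb q)`_i`_j) -> p = q.
Proof.
by move=> pq; apply/symb_inj/polyP => i; apply/polyP => j; apply: pq.
Qed.

Fact pdo_addA : associative (fun p q => Pdo (symb p + symb q)).
Proof. by move=> p q r; congr Pdo; rewrite addrA. Qed.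
Fact pdo_addC : commutative (fun p q => Pdo (symb p + symb q)).
Proof. by move=> p q; congr Pdo; rewrite addrC. Qed.
Fact pdo_add0 : left_id (Pdo 0) (fun p q => Pdo (symb p + symb q)).
Proof. by case=> p; congr Pdo; rewrite add0r. Qed.
Fact pdo_addN : left_inverse (Pdo 0) (fun p => Pdo (- symb p))
  (fun p q => Pdo (symb p + symb q)).
Proof. by move=> p; congr Pdo; rewrite addNr. Qed.

HB.instance Definition _ :=
  GRing.isZmodule.Build (pdo F) pdo_addA pdo_addC pdo_add0 pdo_addN.

Definition pdo_scale a p := Pdo (a%:P *: symb p).

Fact pdo_scaleA a b p : pdo_scale a (pdo_scale b p) = pdo_scale (a * b) p.
Proof. by congr Pdo; rewrite scalerA polyCM. Qed.
Fact pdo_scale1 : left_id 1 pdo_scale.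
Proof. by case=> p; congr Pdo; rewrite scale1r. Qed.
Fact pdo_scaleDr : right_distributive pdo_scale +%R.
Proof. by move=> a p q; congr Pdo; rewrite scalerDr. Qed.
Fact pdo_scaleDl p : {morph pdo_scale^~ p : a b / a + b}.
Proof. by move=> a b; congr Pdo; rewrite polyCD scalerDl. Qed.

HB.instance Definition _ := GRing.Zmodule_isLmodule.Build F (pdo F)
  pdo_scaleA pdo_scale1 pdo_scaleDr pdo_scaleDl.

Lemma symbD p q : symb (p + q) = symb p + symb q. Proof. by []. Qed.
Lemma symbN p : symb (- p) = - symb p. Proof. by []. Qed.
Lemma symb0 : symb (0 : pdo F) = 0. Proof. by []. Qed.
Lemma symbZ a p : symb (a *: p) = a%:P *: symb p. Proof. by []. Qed.

(** [\sum_(i, j) a_ij X^i Y^j] applied to [v], where [X] and [Y] give the actions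
    of [d_x] and [d_y] on [V]. *)
Definition pdo_act (V : lmodType F) (X Y : V -> V) (p : pdo F) (v : V) : V :=
  \sum_(i < size (symb p)) \sum_(j < size (symb p)`_i)
     (symb p)`_i`_j *: iter i X (iter j Y v).

(** [dmono a i j] is [a d_x^i d_y^j]. *)
Definition dmono a i j : pdo F := Pdo ((a *: 'X^j) *: 'X^i).

Lemma coef_dmono a i j m n :
  (symb (dmono a i j))`_m`_n = a *+ ((m == i) && (n == j)).
Proof.
rewrite coefZ coefXn; case: eqP => _ /=; last by rewrite mulr0 coef0.
by rewrite mulr1 coefZ coefXn; case: eqP; rewrite /= ?mulr1 ?mulr0.
Qed.

Lemma pdo_sum_dmono p :
  p = \sum_(i < size (symb p)) \sum_(j < size (symb p)`_i)
        dmono (symb p)`_i`_j i j.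
Proof.
apply: symb_inj.
have sumE I (r : seq I) (G : I -> pdo F) :
    symb (\sum_(i <- r) G i) = \sum_(i <- r) symb (G i).
  by elim: r => [|i r IH]; rewrite ?big_nil ?symb0 // !big_cons symbD IH.
rewrite sumE -[LHS]coefK poly_def; apply: eq_bigr => i _.
rewrite sumE -{1}[(symb p)`_i]coefK poly_def scaler_suml.
exact: eq_bigr.
Qed.

Lemma pdo_ind (P : pdo F -> Prop) :
  P 0 -> (forall p q, P p -> P q -> P (p + q)) ->
  (forall a i j, P (dmono a i j)) -> forall p, P p.
Proof.
move=> P0 PD Pm p; rewrite (pdo_sum_dmono p).
by apply: (big_ind P) => // i _; apply: (big_ind P).
Qed.

Section Act.
Variables (V : lmodType F) (X Y : V -> V).

Lemma pdo_act_wide m n p v :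
    (size (symb p) <= m)%N -> (forall i, (size ((symb p)`_i)%R <= n)%N) ->
  pdo_act X Y p v =
  \sum_(i < m) \sum_(j < n) (symb p)`_i`_j *: iter i X (iter j Y v).
Proof.
move=> hm hn; rewrite /pdo_act.
rewrite (big_ord_widen_cond m predT (fun i =>
  \sum_(j < size (symb p)`_i) (symb p)`_i`_j *: iter i X (iter j Y v))) //.
rewrite big_mkcond; apply: eq_bigr => i _ /=.
rewrite (big_ord_widen_cond n predT
  (fun j => (symb p)`_i`_j *: iter i X (iter j Y v))) //.
rewrite [in LHS]big_mkcond /=; case: ltnP => hi.
  apply: eq_bigr => j _; case: ltnP => // hj.
  by rewrite (nth_default _ hj) scale0r.
by rewrite big1 // => j _; rewrite (nth_default _ hi) coef0 scale0r.
Qed.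

Lemma symb_bound p :
  exists n, (size (symb p) <= n)%N /\ (forall i, (size ((symb p)`_i)%R <= n)%N).
Proof.
exists (maxn (size (symb p)) (\max_(i < size (symb p)) size ((symb p)`_i)%R)).
split=> [|i]; first exact: leq_maxl.
case: (ltnP i (size (symb p))) => hi; last by rewrite nth_default // size_poly0.
rewrite leq_max; apply/orP; right.
exact: (leq_bigmax (Ordinal hi)).
Qed.

Lemma pdo_act0l v : pdo_act X Y 0 v = 0.
Proof. by rewrite /pdo_act symb0 size_poly0 big_ord0. Qed.

Lemma pdo_actDl p q v :
  pdo_act X Y (p + q) v = pdo_act X Y p v + pdo_act X Y q v.
Proof.
have [m [hm hm']] := symb_bound p; have [n [hn hn']] := symb_bound q.
have [r [hr hr']] := symb_bound (p + q).
pose M := maxn (maxn m n) r.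
have mM : (m <= M)%N by rewrite /M -maxnA leq_maxl.
have nM : (n <= M)%N by rewrite /M maxnAC leq_maxr.
have rM : (r <= M)%N by rewrite /M leq_maxr.
have W s t : (size (symb t) <= s)%N -> (forall i, (size ((symb t)`_i)%R <= s)%N) ->
    (s <= M)%N -> pdo_act X Y t v =
    \sum_(i < M) \sum_(j < M) (symb t)`_i`_j *: iter i X (iter j Y v).
  move=> h1 h2 h3; apply: pdo_act_wide; first exact: leq_trans h3.
  by move=> i; apply: leq_trans h3.
rewrite (W m p) // (W n q) // (W r (p + q)) // -big_split.
apply: eq_bigr => i _ /=; rewrite -big_split; apply: eq_bigr => j _ /=.
by rewrite !coefD scalerDl.
Qed.

Lemma pdo_act_dmono a i j v :
  pdo_act X Y (dmono a i j) v = a *: iter i X (iter j Y v).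
Proof.
pose M := (maxn i j).+1.
have iM : (i < M)%N by rewrite ltnS leq_maxl.
have jM : (j < M)%N by rewrite ltnS leq_maxr.
rewrite (@pdo_act_wide M M).
- rewrite (bigD1 (Ordinal iM)) //= [X in _ + X]big1 ?addr0; last first.
    move=> m; rewrite -val_eqE /= => mi; rewrite big1 // => n _.
    by rewrite coef_dmono (negPf mi) scale0r.
  rewrite (bigD1 (Ordinal jM)) //= big1 ?addr0; last first.
    move=> n; rewrite -val_eqE /= => nj.
    by rewrite coef_dmono (negPf nj) andbF scale0r.
  by rewrite coef_dmono !eqxx.
- apply/leq_sizeP => m hm; apply/polyP => n; rewrite coef_dmono coef0.
  by rewrite gtn_eqF // (leq_trans iM).
- move=> m; apply/leq_sizeP => n hn; rewrite coef_dmono.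
  by rewrite (@gtn_eqF j n) ?andbF // (leq_trans jM).
Qed.


Hypotheses (XD : {morph X : u v / u + v}) (YD : {morph Y : u v / u + v}).

Lemma iterXYD i j u v : iter i X (iter j Y (u + v)) =
  iter i X (iter j Y u) + iter i X (iter j Y v).
Proof.
have iterD (Z : V -> V) n : {morph Z : a b / a + b} ->
    {morph iter n Z : a b / a + b}.
  by move=> ZD; elim: n => [|n IH] a b //=; rewrite IH ZD.
by rewrite !iterD.
Qed.

Lemma pdo_actDr p : {morph pdo_act X Y p : u v / u + v}.
Proof.
move=> u v; rewrite /pdo_act -big_split; apply: eq_bigr => i _ /=.
rewrite -big_split; apply: eq_bigr => j _ /=; rewrite -scalerDr.
by rewrite iterXYD.
Qed.

Lemma pdo_actZl a p v : pdo_act X Y (a *: p) v = a *: pdo_act X Y p v.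
Proof.
elim/pdo_ind: p => [|p q hp hq|b i j]; first by rewrite scaler0 pdo_act0l scaler0.
  by rewrite scalerDr !pdo_actDl hp hq scalerDr.
have -> : a *: dmono b i j = dmono (a * b) i j.
  by apply: symb_inj; rewrite symbZ /dmono /= scalerA mul_polyC scalerA.
by rewrite !pdo_act_dmono scalerA.
Qed.

End Act.

(** Left multiplication by [d_x] and [d_y]:
    [d_x (a d_x^i d_y^j) = a d_x^(i+1) d_y^j + (d_x a) d_x^i d_y^j]. *)
Definition dx_lmul (p : pdo F) : pdo F :=
  Pdo ('X * symb p + map_poly (map_poly (@dx F)) (symb p)).
Definition dy_lmul (p : pdo F) : pdo F :=
  Pdo ('X%:P * symb p + map_poly (map_poly (@dy F)) (symb p)).

Lemma dx0 : dx (0 : F) = 0.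
Proof. by apply: (@addrI _ (dx 0)); rewrite -dxD !addr0. Qed.
Lemma dy0 : dy (0 : F) = 0.
Proof. by apply: (@addrI _ (dy 0)); rewrite -dyD !addr0. Qed.
Lemma dx1 : dx (1 : F) = 0.
Proof.
by apply: (@addrI _ (dx 1)); rewrite addr0 -[RHS](congr1 _ (mulr1 1)) dxM mulr1 mul1r.
Qed.
Lemma dy1 : dy (1 : F) = 0.
Proof.
by apply: (@addrI _ (dy 1)); rewrite addr0 -[RHS](congr1 _ (mulr1 1)) dyM mulr1 mul1r.
Qed.

Lemma coef_map2 (d : F -> F) (c : {poly {poly F}}) i j : d 0 = 0 ->
  (map_poly (map_poly d) c)`_i`_j = d c`_i`_j.
Proof.
move=> d0; rewrite coef_map_id0; last by rewrite /map_poly size_poly0 poly_def big_ord0.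
by rewrite coef_map_id0.
Qed.

Lemma coef_dx_lmul p i j : (symb (dx_lmul p))`_i`_j =
  (if i is i'.+1 then (symb p)`_i'`_j else 0) + dx (symb p)`_i`_j.
Proof.
rewrite /dx_lmul /= !coefD coef_map2 ?dx0 //; congr (_ + _).
by rewrite coefXM; case: i => [|i] /=; rewrite ?coef0.
Qed.

Lemma coef_dy_lmul p i j : (symb (dy_lmul p))`_i`_j =
  (if j is j'.+1 then (symb p)`_i`_j' else 0) + dy (symb p)`_i`_j.
Proof.
rewrite /dy_lmul /= !coefD coef_map2 ?dy0 //; congr (_ + _).
by rewrite coefCM coefXM; case: j.
Qed.

Lemma coefDs p q i j : (symb (p + q))`_i`_j = (symb p)`_i`_j + (symb q)`_i`_j.
Proof. by rewrite symbD !coefD. Qed.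

Lemma coefZs a p i j : (symb (a *: p))`_i`_j = a * (symb p)`_i`_j.
Proof. by rewrite symbZ coefZ coefCM. Qed.

Lemma dx_lmulD : {morph dx_lmul : p q / p + q}.
Proof.
move=> p q; apply: symbP => i j; rewrite coefDs !coef_dx_lmul !coefDs dxD.
by case: i => [|i]; rewrite ?coefDs ?addr0 ?add0r // addrACA.
Qed.

Lemma dy_lmulD : {morph dy_lmul : p q / p + q}.
Proof.
move=> p q; apply: symbP => i j; rewrite coefDs !coef_dy_lmul !coefDs dyD.
by case: j => [|j]; rewrite ?coefDs ?addr0 ?add0r // addrACA.
Qed.

Lemma dx_lmulZ a p : dx_lmul (a *: p) = a *: dx_lmul p + dx a *: p.
Proof.
apply: symbP => i j; rewrite coefDs !coefZs !coef_dx_lmul !coefZs.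
rewrite dxM mulrDr; case: i => [|i]; last first.
  by rewrite coefZs -addrA [_ + dx a * _]addrC.
by rewrite mulr0 !add0r addrC.
Qed.

Lemma dy_lmulZ a p : dy_lmul (a *: p) = a *: dy_lmul p + dy a *: p.
Proof.
apply: symbP => i j; rewrite coefDs !coefZs !coef_dy_lmul !coefZs.
rewrite dyM mulrDr; case: j => [|j]; last first.
  by rewrite coefZs -addrA [_ + dy a * _]addrC.
by rewrite mulr0 !add0r addrC.
Qed.

Lemma dxy_lmulC p : dx_lmul (dy_lmul p) = dy_lmul (dx_lmul p).
Proof.
apply: symbP => i j; rewrite coef_dx_lmul !coef_dy_lmul !coef_dx_lmul.
rewrite dyD dxD dxdyC.
case: i j => [|i] [|j]; rewrite ?coef_dy_lmul ?coef_dx_lmul ?dx0 ?dy0 ?add0r ?addr0 //.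
by rewrite addrACA -!addrA; congr (_ + _); rewrite addrCA.
Qed.

Lemma dx_lmul_dmono a i j :
  dx_lmul (dmono a i j) = dmono a i.+1 j + dmono (dx a) i j.
Proof.
apply: symbP => m n; rewrite coefDs coef_dx_lmul !coef_dmono.
congr (_ + _); last by case: (_ && _); rewrite ?dx0.
by case: m => [|m]; rewrite ?coef_dmono.
Qed.

Lemma dy_lmul_dmono a i j :
  dy_lmul (dmono a i j) = dmono a i j.+1 + dmono (dy a) i j.
Proof.
apply: symbP => m n; rewrite coefDs coef_dy_lmul !coef_dmono.
congr (_ + _); last by case: (_ && _); rewrite ?dy0.
by case: n => [|n]; rewrite ?coef_dmono ?andbF.
Qed.

Definition pdo_mul : pdo F -> pdo F -> pdo F := pdo_act dx_lmul dy_lmul.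
Definition pdo_one : pdo F := dmono 1 0 0.

(** Operators act on every module on which [X], [Y] satisfy the relations of
    [d_x], [d_y]. *)
Lemma pdo_act_mul (V : lmodType F) (X Y : V -> V) p q v :
    {morph X : u v / u + v} -> {morph Y : u v / u + v} ->
    (forall a u, X (a *: u) = a *: X u + dx a *: u) ->
    (forall a u, Y (a *: u) = a *: Y u + dy a *: u) ->
    (forall u, X (Y u) = Y (X u)) ->
  pdo_act X Y (pdo_mul p q) v = pdo_act X Y p (pdo_act X Y q v).
Proof.
move=> XD YD XZ YZ XYC.
have YiC i u : Y (iter i X u) = iter i X (Y u).
  by elim: i => //= i IH; rewrite -XYC IH.
have X0 : X 0 = 0 by apply: (@addrI _ (X 0)); rewrite -XD !addr0.
have Y0 : Y 0 = 0 by apply: (@addrI _ (Y 0)); rewrite -YD !addr0.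
have dx00 : dx_lmul 0 = 0 by apply: (@addrI _ (dx_lmul 0)); rewrite -dx_lmulD !addr0.
have dy00 : dy_lmul 0 = 0 by apply: (@addrI _ (dy_lmul 0)); rewrite -dy_lmulD !addr0.
have HX r : pdo_act X Y (dx_lmul r) v = X (pdo_act X Y r v).
  elim/pdo_ind: r => [|r s hr hs|a i j].
  - by rewrite dx00 pdo_act0l X0.
  - by rewrite dx_lmulD !pdo_actDl hr hs XD.
  - by rewrite dx_lmul_dmono pdo_actDl !pdo_act_dmono XZ.
have HY r : pdo_act X Y (dy_lmul r) v = Y (pdo_act X Y r v).
  elim/pdo_ind: r => [|r s hr hs|a i j].
  - by rewrite dy00 pdo_act0l Y0.
  - by rewrite dy_lmulD !pdo_actDl hr hs YD.
  - by rewrite dy_lmul_dmono pdo_actDl !pdo_act_dmono YZ YiC.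
elim/pdo_ind: p => [|p p' hp hp'|a i j].
- by rewrite /pdo_mul !pdo_act0l.
- by rewrite /pdo_mul !pdo_actDl -/(pdo_mul _ _) -/(pdo_mul _ _) hp hp'.
rewrite /pdo_mul !pdo_act_dmono pdo_actZl; congr (_ *: _).
elim: i => [|i IH] /=; last by rewrite HX IH.
by elim: j => [|j IH] //=; rewrite HY IH.
Qed.

Fact pdo_mulA : associative pdo_mul.
Proof.
move=> p q r; symmetry; apply: pdo_act_mul.
- exact: dx_lmulD.
- exact: dy_lmulD.
- exact: dx_lmulZ.
- exact: dy_lmulZ.
- exact: dxy_lmulC.
Qed.
Fact pdo_mul1l : left_id pdo_one pdo_mul.
Proof. by move=> p; rewrite /pdo_mul pdo_act_dmono scale1r. Qed.
Fact pdo_mul1r : right_id pdo_one pdo_mul.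
Proof.
have z i j : dmono 0 i j = 0.
  by apply: symb_inj; rewrite /dmono /= !scale0r.
have H i j : iter i dx_lmul (iter j dy_lmul pdo_one) = dmono 1 i j.
  elim: i => [|i IH] /=; last by rewrite IH dx_lmul_dmono dx1 z addr0.
  by elim: j => [|j IH] //=; rewrite IH dy_lmul_dmono dy1 z addr0.
elim/pdo_ind => [|p q hp hq|a i j]; first exact: pdo_act0l.
  by rewrite /pdo_mul pdo_actDl -!/(pdo_mul _ _) hp hq.
rewrite /pdo_mul pdo_act_dmono H.
by apply: symb_inj; rewrite symbZ /dmono /= scalerA scale1r mul_polyC.
Qed.
Fact pdo_mulDl : left_distributive pdo_mul +%R.
Proof. by move=> p q r; apply: pdo_actDl. Qed.
Fact pdo_mulDr : right_distributive pdo_mul +%R.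
Proof. by move=> p q r; apply: pdo_actDr; [exact: dx_lmulD|exact: dy_lmulD]. Qed.
Fact pdo_one_neq0 : pdo_one != 0.
Proof.
apply/eqP => /(congr1 (fun p => (symb p)`_0`_0)).
by rewrite coef_dmono symb0 !coef0 /=; apply/eqP; exact: oner_neq0.
Qed.

HB.instance Definition _ := GRing.Zmodule_isNzRing.Build (pdo F)
  pdo_mulA pdo_mul1l pdo_mul1r pdo_mulDl pdo_mulDr pdo_one_neq0.

Definition pdoC a : pdo F := dmono a 0 0.
Definition Dx : pdo F := dmono 1 1 0.
Definition Dy : pdo F := dmono 1 0 1.

Lemma pdoCM a p : pdoC a * p = a *: p.
Proof. exact: pdo_act_dmono. Qed.
Lemma DxM p : Dx * p = dx_lmul p.
Proof. by rewrite -[RHS]scale1r; exact: pdo_act_dmono. Qed.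
Lemma DyM p : Dy * p = dy_lmul p.
Proof. by rewrite -[RHS]scale1r; exact: pdo_act_dmono. Qed.
Lemma Dx_pdoC a : Dx * pdoC a = pdoC a * Dx + pdoC (dx a).
Proof.
rewrite DxM dx_lmul_dmono pdoCM; congr (_ + _).
by apply: symbP => i j; rewrite coefZs !coef_dmono mulr_natr.
Qed.
Lemma Dy_pdoC a : Dy * pdoC a = pdoC a * Dy + pdoC (dy a).
Proof.
rewrite DyM dy_lmul_dmono pdoCM; congr (_ + _).
by apply: symbP => i j; rewrite coefZs !coef_dmono mulr_natr.
Qed.
Lemma DxDyC : Dx * Dy = Dy * Dx.
Proof. by rewrite -[Dx in RHS]mulr1 -[Dy in LHS]mulr1 !DxM !DyM dxy_lmulC. Qed.
Lemma dmonoE a i j : dmono a i j = pdoC a * Dx ^+ i * Dy ^+ j.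
Proof.
suff H : Dx ^+ i * Dy ^+ j = dmono 1 i j.
  rewrite -mulrA H pdoCM; apply: symbP => m n.
  by rewrite coefZs !coef_dmono mulr_natr.
have z m n : dmono 0 m n = 0 by apply: symb_inj; rewrite /dmono /= !scale0r.
elim: i => [|i IH].
  rewrite mul1r; elim: j => [|j IH]; first by [].
  by rewrite exprS IH DyM dy_lmul_dmono dy1 z addr0.
by rewrite exprS -mulrA IH DxM dx_lmul_dmono dx1 z addr0.
Qed.

End PdoModule.

(** The nonzero elements of the subring [F[d_y]]. *)
Definition Fdy_nonzero (F : diffFieldType) : set (pdo F) :=
  [set b | b != 0 /\ exists c : {poly F}, b = Pdo c%:P].

Definition pdo_order_le (F : diffFieldType) (z : nat) (p : pdo F) : Prop :=
  forall i j, (symb p)`_i`_j != 0 -> (i + j <= z)%N.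

(** * Left ideals, Hilbert-Kolchin polynomial, localization *)

Definition left_ideal (A : nzRingType) (J : set A) : Prop :=
  [/\ J 0, forall a b, J a -> J b -> J (a + b) & forall a b, J b -> J (a * b)].

Definition left_ideal_gen (A : nzRingType) (S : set A) : set A :=
  [set a | forall J : set A, left_ideal J -> S `<=` J -> J a].

(** The [F]-space of operators of order at most [z] modulo those lying in [J]
    has a basis of [n] elements, the classes of the [e i]. *)
Definition hilbert_dim (F : diffFieldType) (J : set (pdo F)) (z n : nat) : Prop :=
  exists e : 'I_n -> pdo F,
    [/\ forall i, pdo_order_le z (e i),
        forall c : 'I_n -> F, J (\sum_i c i *: e i) -> forall i, c i = 0
      & forall p, pdo_order_le z p ->
          exists c : 'I_n -> F, J (p - \sum_i c i *: e i)].

Definition hilbert_kolchin_poly (F : diffFieldType) (J : set (pdo F))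
    (K : {poly rat}) : Prop :=
  exists z0 : nat, forall z, (z0 <= z)%N ->
    exists n, hilbert_dim J z n /\ n%:R = K.[z%:R].

Definition differential_type (F : diffFieldType) (J : set (pdo F)) (t : nat) : Prop :=
  exists2 K, hilbert_kolchin_poly J K & size K = t.+1.

(** [B], with [phi], is the two-sided Ore localization [A S^-1 = S^-1 A]; [phi] is
    injective since the [S] of interest consists of regular elements. *)
Definition ore_localization (A : nzRingType) (S : set A)
    (B : unitRingType) (phi : {rmorphism A -> B}) : Prop :=
  [/\ injective phi, forall b, S b -> phi b \is a GRing.unit,
      forall r, exists a b, S b /\ r = phi a / phi b
    & forall r, exists a b, S b /\ r = (phi b)^-1 * phi a].

(** * Fractional-derivatives series *)

(** [G_{s_2,...,s_k}(f_1,...,f_k)] is given by [s, f] indexed from [ord0], with the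
    convention [s_1 = 1]. *)
Definition symbol_exponents (n : nat) (s : 'I_n.+1 -> rat) : Prop :=
  [/\ s ord0 = 1, forall i j : 'I_n.+1, (i < j)%N -> s j < s i & forall i, 0 < s i].

Definition common_denom (n : nat) (s : 'I_n.+1 -> rat) : nat :=
  \big[lcmn/1%N]_(i < n.+1) `|denq (s i)|%N.

(** A series [\sum_t (H t) G^(t)] is encoded by its coefficients [H : rat -> F]. *)
Definition is_fd_series (F : diffFieldType) (n : nat) (s : 'I_n.+1 -> rat)
    (H : rat -> F) : Prop :=
  exists s0 : rat, s0 * (common_denom s)%:R \is a Num.int /\
    forall t, H t != 0 -> exists i : nat, t = s0 - i%:R / (common_denom s)%:R.

(** [d (h G^(t)) = (d h) G^(t) + h \sum_i (d f_i) G^(s_i + t)]; hence the coefficient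
    at [t] of [d H] collects contributions of [H] at [t] and at the [t - s_i]. *)
Definition series_der (F : diffFieldType) (n : nat) (s : 'I_n.+1 -> rat)
    (f : 'I_n.+1 -> F) (d : F -> F) (H : rat -> F) : rat -> F :=
  fun t => d (H t) + \sum_(i < n.+1) H (t - s i) * d (f i).

Definition series_act (F : diffFieldType) (n : nat) (s : 'I_n.+1 -> rat)
    (f : 'I_n.+1 -> F) (p : pdo F) (H : rat -> F) : rat -> F :=
  @pdo_act F (rat -> F^o)%type
    (series_der s f (@dx F)) (series_der s f (@dy F)) p H.

Definition is_solution (F : diffFieldType) (n : nat) (s : 'I_n.+1 -> rat)
    (f : 'I_n.+1 -> F) (H : rat -> F) (p : pdo F) : Prop :=
  series_act s f p H = 0.

Definition is_ideal_solution (F : diffFieldType) (n : nat) (s : 'I_n.+1 -> rat)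
    (f : 'I_n.+1 -> F) (H : rat -> F) (J : set (pdo F)) : Prop :=
  forall p0, J p0 -> is_solution s f H p0.

(* Main.v *)
(** For [p0] in [J], clearing denominators in [iota p0 = r * iota p] gives
    [b * p0 = a * p] with [b] a nonzero element of [F[d_y]], so [b] kills
    [K := p0 H] as soon as [p H = 0].  Since [d_y f_1 != 0], each application of
    [d_y] shifts the leading exponent of a series by exactly [1], multiplying the
    leading coefficient by [d_y f_1]; hence a nonzero [K] with leading term
    [h G^(t)] would give [b K] the leading term
    [b_m * (d_y f_1)^m * h G^(t + m)], where [m] is the order of [b]. *)
Require Import Defs.
From HB Require Import structures.
From mathcomp Require Import all_boot all_order all_algebra.
From mathcomp Require Import boolp classical_sets functions.
From mathcomp Require Import ring.

Set Implicit Arguments.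
Unset Strict Implicit.
Unset Printing Implicit Defensive.

Import Order.TTheory GRing.Theory Num.Theory.
Local Open Scope classical_set_scope.
Local Open Scope ring_scope.

Section SeriesDerivation.
Variables (F : diffFieldType) (n : nat) (s : 'I_n.+1 -> rat) (f : 'I_n.+1 -> F).
Implicit Types (H : rat -> F^o) (d : F -> F) (p q b : pdo F).

(** * Series as a left module over [pdo F] *)

Lemma series_derD d : {morph d : u v / u + v} ->
  {morph (series_der s f d : (rat -> F^o) -> rat -> F^o) : H K / H + K}.
Proof.
move=> dD H K; apply/funext => t.
have -> : (series_der s f d H + series_der s f d K : rat -> F^o) t =
  series_der s f d H t + series_der s f d K t by [].
rewrite /series_der [(H + K) t]/(H t + K t) dD addrACA -big_split.
by congr (_ + _); apply: eq_bigr => i _; rewrite mulrDl.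
Qed.

Lemma series_derZ d a H : (forall u v, d (u * v) = d u * v + u * d v) ->
  series_der s f d (a *: H) =
  a *: (series_der s f d H : rat -> F^o) + d a *: H.
Proof.
move=> dM; apply/funext => t.
rewrite /series_der [RHS]/(a * (_ + _) + d a * H t) [(a *: H) t]/(a * H t).
rewrite dM mulrDr mulr_sumr [RHS]addrC addrA; congr (_ + _).
by apply: eq_bigr => i _; rewrite mulrA.
Qed.

(** Expanded so that the symmetry in [d] and [e] is visible: the mixed first-order sums swap with
    each other, the terms in [d (e _)] need only that [d] and [e] commute, and the double sum is
    invariant under exchanging [i] and [j]. *)
Lemma series_der_comp d e H t : {morph d : u v / u + v} -> d 0 = 0 ->
    (forall u v, d (u * v) = d u * v + u * d v) ->
  series_der s f d (series_der s f e H) t =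
  d (e (H t)) + (\sum_i d (H (t - s i)) * e (f i) +
                 \sum_i e (H (t - s i)) * d (f i))
  + (\sum_i H (t - s i) * d (e (f i)) +
     \sum_i \sum_j H (t - s i - s j) * e (f j) * d (f i)).
Proof.
move=> dD d0 dM; rewrite /series_der dD (big_morph d dD d0).
under eq_bigr do rewrite dM.
under [X in _ + _ + X]eq_bigr do rewrite mulrDl mulr_suml.
by rewrite !big_split /= -!addrA; congr (_ + (_ + _)); rewrite addrCA.
Qed.

Lemma series_derC H :
  series_der s f (@dx F) (series_der s f (@dy F) H) =
  series_der s f (@dy F) (series_der s f (@dx F) H).
Proof.
apply/funext => t; rewrite !series_der_comp ?dx0 ?dy0 //;
  [|exact: dyD|exact: dyM|exact: dxD|exact: dxM].
rewrite dxdyC [X in _ + X + _]addrC; congr (_ + _ + (_ + _)).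
  by apply: eq_bigr => i _; rewrite dxdyC.
rewrite exchange_big; apply: eq_bigr => i _; apply: eq_bigr => j _ /=.
by rewrite mulrAC addrAC.
Qed.

Lemma series_act_mul p q H :
  series_act s f (p * q) H = series_act s f p (series_act s f q H).
Proof.
apply: (@pdo_act_mul F (rat -> F^o)%type).
- exact: series_derD (@dxD F).
- exact: series_derD (@dyD F).
- by move=> a u; apply: series_derZ; apply: dxM.
- by move=> a u; apply: series_derZ; apply: dyM.
- exact: series_derC.
Qed.

Lemma series_act0 p : series_act s f p 0 = 0.
Proof.
apply: (@addrI _ (series_act s f p 0 : rat -> F^o)).
have := pdo_actDr (series_derD (@dxD F)) (series_derD (@dyD F)) p 0 0.
by rewrite /series_act !addr0 => <-.
Qed.

(** * Leading terms under derivations and under operators in [F[d_y]] *)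

Hypothesis s_exp : symbol_exponents s.

Lemma symbol_exponent_lt1 i : i != ord0 -> s i < 1.
Proof. by case: s_exp => <- sdec _ i0; apply: sdec; rewrite lt0n. Qed.

Lemma symbol_exponent_le1 i : s i <= 1.
Proof.
have [->|/symbol_exponent_lt1/ltW//] := eqVneq i ord0.
by case: s_exp => ->.
Qed.

Section Leading.
Variables (d : F -> F).
Hypothesis d0 : d 0 = 0.

(** At [t + 1] the summand [i] reads [K] at [t + (1 - s i)], which exceeds [t] unless [i = ord0]; so
    only the summand with exponent [1] survives. *)
Lemma series_der_lead K t : (forall t', t < t' -> K t' = 0) ->
  (forall t', t + 1 < t' -> series_der s f d K t' = 0) /\
  series_der s f d K (t + 1) = K t * d (f ord0).
Proof.
have [s0 _ _] := s_exp.
move=> Kt; split=> [t' tt'|]; rewrite /series_der.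
  rewrite Kt ?d0 ?add0r; last by rewrite (lt_trans _ tt') // ltrDl.
  rewrite big1 // => i _; rewrite Kt ?mul0r // ltrBrDr (le_lt_trans _ tt') //.
  by rewrite lerD2l symbol_exponent_le1.
rewrite Kt ?ltrDl // d0 add0r (bigD1 ord0) //= s0 addrK big1 ?addr0 // => i i0.
by rewrite Kt ?mul0r // -addrA ltrDl subr_gt0 symbol_exponent_lt1.
Qed.

Lemma iter_series_der_lead K t j : (forall t', t < t' -> K t' = 0) ->
  (forall t', t + j%:R < t' -> iter j (series_der s f d) K t' = 0) /\
  iter j (series_der s f d) K (t + j%:R) = K t * d (f ord0) ^+ j.
Proof.
move=> Kt; elim: j => [|j [IH0 IH]]; first by rewrite addr0 expr0 mulr1.
have [E0 E] := series_der_lead IH0.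
by rewrite -natr1 addrA; split=> //=; rewrite E IH exprSr mulrA.
Qed.

End Leading.

Lemma series_act_Fdy (c : {poly F}) K :
  series_act s f (Pdo c%:P) K =
  \sum_(j < size c) c`_j *: (iter j (series_der s f (@dy F)) K : rat -> F^o).
Proof.
rewrite /series_act (@pdo_act_wide _ _ _ _ 1 (size c)) /=.
- by rewrite big_ord1 coefC.
- exact: size_polyC_leq1.
- by move=> i; rewrite coefC; case: ifP; rewrite ?size_poly0.
Qed.

Lemma Fdy_act_lead_neq0 b K t : dy (f ord0) != 0 -> Fdy_nonzero b ->
  (forall t', t < t' -> K t' = 0) -> K t != 0 -> series_act s f b K <> 0.
Proof.
move=> fn0 [bn0 [c bc]] Kt Ktn0 bK0.
have cn0 : c != 0 by apply: contra_neq bn0 => c0; rewrite bc c0.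
move: bK0; rewrite bc series_act_Fdy.
(* Here [(size c).-1] is the degree of [c]. A lower power [d_y^i] yields a series vanishing above
   [t + i], so at this exponent only the top power contributes. *)
move/(congr1 (fun L => L (t + (size c).-1%:R))).
have sumE (m : nat) (L : 'I_m -> rat -> F^o) u : (\sum_i L i) u = \sum_i L i u.
  by rewrite fct_sumE.
rewrite sumE -(prednK (n := size c)) ?size_poly_gt0 // big_ord_recr /= big1 => [|i _].
  have [_ E] := iter_series_der_lead (dy0 F) (size c).-1 Kt.
  rewrite fctE E add0r; apply/eqP; rewrite /GRing.scale /= !mulf_neq0 ?expf_neq0 //.
  by rewrite -lead_coefE lead_coef_eq0.
have [E _] := iter_series_der_lead (dy0 F) i Kt.
by rewrite fctE E ?scaler0 // ltrD2l ltr_nat.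
Qed.

(** * Supports bounded above on a grid of step [1/q] *)

Lemma common_denom_gt0 : (0 < common_denom s)%N.
Proof.
apply: (big_ind (fun m => (0 < m)%N)) => // [m k m0 k0|i _].
  by rewrite lcmn_gt0 m0.
by rewrite absz_gt0 denq_neq0.
Qed.

(** A shift by [s i] is thus a shift by [1] followed by whole grid steps down, so derivations keep
    supports on the grid. The denominator of [s i] divides the common one, and [s i <= 1] gives the
    sign. *)
Lemma exponent_common_denom i : exists m : nat, 1 - s i = m%:R / (common_denom s)%:R.
Proof.
have q0 : ((common_denom s)%:R : rat) != 0.
  by rewrite pnatr_eq0 -lt0n common_denom_gt0.
have dv : (`|denq (s i)|%N %| common_denom s)%N.
  by rewrite /common_denom (bigD1 i) //= dvdn_lcml.
have si_int : (1 - s i) * (common_denom s)%:R \is a Num.int.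
  rewrite mulrBl mul1r rpredB ?rpred_nat //.
  case/dvdnP: dv => k ->; rewrite natrM mulrCA rpredM ?rpred_nat //.
  rewrite -{1}(divq_num_den (s i)).
  by rewrite pmulrn absz_denq divfK ?intr_eq0 ?denq_neq0 ?intr_int.
have /natrP[m mE] : (1 - s i) * (common_denom s)%:R \is a Num.nat.
  by rewrite natrEint si_int mulr_ge0 // subr_ge0 symbol_exponent_le1.
by exists m; rewrite -mE mulfK.
Qed.

(* The anchor [s0] is kept fixed so that sums of such series are of the same form. *)
Definition fd_anchored (s0 : rat) H : Prop :=
  exists N : nat, forall t, H t != 0 ->
    exists i : nat, t = s0 + N%:R - i%:R / (common_denom s)%:R.

Lemma fd_series_anchored H : is_fd_series s H -> exists s0, fd_anchored s0 H.
Proof.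
by case=> s0 [_ Hs0]; exists s0, 0 => t /Hs0[i ->]; exists i; rewrite addr0.
Qed.

(** Raising the upper bound by [k] is offset by [k * q] further grid steps down; this brings two
    different bounds to a common one. *)
Lemma fd_anchored_exponentD (s0 : rat) (N k i : nat) :
  s0 + N%:R - i%:R / (common_denom s)%:R =
  s0 + (N + k)%:R - (i + k * common_denom s)%:R / (common_denom s)%:R.
Proof.
have q0 : ((common_denom s)%:R : rat) != 0.
  by rewrite pnatr_eq0 -lt0n common_denom_gt0.
by rewrite !natrD natrM mulrDl mulfK // opprD [- _ - k%:R]addrC addrA addrA addrK.
Qed.

Lemma fd_anchoredD s0 H K :
  fd_anchored s0 H -> fd_anchored s0 K -> fd_anchored s0 (H + K).
Proof.
move=> [N HN] [M KM]; exists (N + M) => t.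
have [Ht|/HN[i ->] _] := eqVneq (H t) 0; last first.
  by rewrite (fd_anchored_exponentD _ _ M); eexists.
rewrite fctE Ht add0r => /KM[i ->].
by rewrite (fd_anchored_exponentD _ _ N) addnC; eexists.
Qed.

Lemma fd_anchoredZ s0 a H : fd_anchored s0 H -> fd_anchored s0 (a *: H).
Proof.
case=> N HN; exists N => t; have [Ht|/HN//] := eqVneq (H t) 0.
by rewrite fctE Ht scaler0 eqxx.
Qed.

Lemma fd_anchored_der s0 d H : d 0 = 0 ->
  fd_anchored s0 H -> fd_anchored s0 (series_der s f d H).
Proof.
move=> d0 [N HN]; exists (N + 1) => t dHt.
have [Ht|/HN[i ->]] := eqVneq (H t) 0; last first.
  by rewrite (fd_anchored_exponentD _ _ 1); eexists.
have [i Hi] : exists i, H (t - s i) != 0.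
  apply/not_existsP => H0; case/eqP: dHt; rewrite /series_der Ht d0 add0r.
  by apply: big1 => i _; have /negP/negPn/eqP -> := H0 i; rewrite mul0r.
have [k tE] := HN _ Hi; have [m mE] := exponent_common_denom i.
(* [t] is [t - s i], which lies [k] steps below the old bound, plus [s i], which is [1] minus [m]
   steps. *)
exists (k + m); rewrite -[t](subrK (s i)) tE natrD [(k + m)%:R]natrD mulrDl -mE.
ring.
Qed.

Lemma fd_anchored_act s0 p H :
  fd_anchored s0 H -> fd_anchored s0 (series_act s f p H).
Proof.
move=> H0; rewrite /series_act; elim/pdo_ind: p => [|p q hp hq|a i j].
- by rewrite pdo_act0l; exists 0 => t; rewrite eqxx.
- by rewrite pdo_actDl; apply: fd_anchoredD.
rewrite pdo_act_dmono; apply: fd_anchoredZ.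
elim: i => [|i IH] /=; last exact: fd_anchored_der (dx0 F) IH.
by elim: j => [|j IH] //=; apply: fd_anchored_der (dy0 F) IH.
Qed.

(** The admissible exponents form a decreasing sequence indexed by [nat], so the least index with a
    nonzero coefficient gives the greatest exponent. *)
Lemma fd_anchored_lead s0 H : fd_anchored s0 H -> H <> 0 ->
  exists2 t, H t != 0 & forall t', t < t' -> H t' = 0.
Proof.
case=> N HN Hn0; pose e i := s0 + N%:R - i%:R / (common_denom s)%:R.
have exi : exists i, H (e i) != 0.
  apply/not_existsP => H0; apply: Hn0; apply/funext => t.
  by apply/eqP/negPn/negP => /[dup] /HN[i ->]; apply: H0.
case: (ex_minnP exi) => i Hi imin; exists (e i) => // t' it'.
apply/eqP/negPn/negP => Ht'; have [k tE] := HN _ Ht'.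
move: Ht' it'; rewrite tE => /imin ik.
have q0 : 0 < ((common_denom s)%:R : rat)^-1.
  by rewrite invr_gt0 ltr0n common_denom_gt0.
by rewrite /e ltrD2l ltrN2 (ltr_pM2r q0) ltr_nat ltnNge ik.
Qed.

Lemma Fdy_act_injective s0 b H : dy (f ord0) != 0 -> Fdy_nonzero b ->
  fd_anchored s0 H -> series_act s f b H = 0 -> H = 0.
Proof.
move=> fn0 b0 H0 bH; apply: contrapT => /(fd_anchored_lead H0)[t Ht tH].
exact: Fdy_act_lead_neq0 fn0 b0 tH Ht bH.
Qed.

End SeriesDerivation.

(** * Clearing denominators and conclusion *)

Lemma ore_left_multiple (A : nzRingType) (S : set A) (B : unitRingType)
    (phi : {rmorphism A -> B}) (J : set A) p p0 :
  ore_localization S phi ->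
  left_ideal_gen (phi @` J) = [set r | exists a : B, r = a * phi p] ->
  J p0 -> exists a b, S b /\ b * p0 = a * p.
Proof.
move=> [phi_inj Sunit _ lfrac] gen Jp0.
have : left_ideal_gen (phi @` J) (phi p0) by move=> I _; apply; exists p0.
(* The left-fraction form [r = (phi b)^-1 * phi a] lets [phi b] cancel by left multiplication;
   injectivity of [phi] then brings the identity back to [A]. *)
rewrite gen => -[r rE]; have [a [b [Sb rab]]] := lfrac r.
exists a, b; split=> //; apply: phi_inj.
by rewrite !rmorphM rE rab mulrA mulVKr ?Sunit.
Qed.

Theorem proposition4p6
  (F : diffFieldType) (F_char0 : [pchar F] =i pred0)
  (F_universal : kolchin_universal F)
  (J : set (pdo F)) (J_ideal : left_ideal J) (J_type1 : differential_type J 1)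
  (R : unitRingType) (iota : {rmorphism pdo F -> R})
  (R_loc : ore_localization (@Fdy_nonzero F) iota)
  (p : pdo F) (p_in_J : J p)
  (p_gen : left_ideal_gen (iota @` J) = [set r | exists a : R, r = a * iota p])
  (n : nat) (s : 'I_n.+1 -> rat) (s_exp : symbol_exponents s)
  (f : 'I_n.+1 -> F) (dyf1 : dy (f ord0) != 0)
  (H : rat -> F) (H_series : is_fd_series s H) :
  is_solution s f H p <-> is_ideal_solution s f H J.
Proof.
(* The converse direction is just [J p]. *)
split=> [pH p0 Jp0|]; last exact.
have [a [b [b0 bp0]]] := ore_left_multiple R_loc p_gen Jp0.
have [s0 H0] := fd_series_anchored H_series.
(* The series [p0 H] inherits a support bounded above on the grid, hence has a leading term if it is
   nonzero. *)
have K0 := fd_anchored_act f s_exp p0 H0.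
apply: (Fdy_act_injective s_exp dyf1 b0 K0).
by rewrite -series_act_mul bp0 series_act_mul pH series_act0.
Qed.
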